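(* Let $\Gamma$ be a graph in $NG(v,k,\lambda;m,s)$ with $k-\lambda-s+m-1=0$. Then $\Gamma$ is isomorphic to one of the following strongly regular graphs: (1) the square lattice graph $L_{2}(s)$; (2) the triangular graph $T(s+1)$, where $s\geq 3$; (3) the complete $s$-partite graph $K_{s\times 2}$ with all parts of size $2$.
   Context: All graphs are finite, simple and undirected. A graph on $v$ vertices is edge-regular with parameters $(v,k,\lambda)$ if it has at least one edge, is $k$-regular, and every two adjacent vertices have exactly $\lambda$ common neighbours. A clique $S$ in a regular graph is $m$-regular if every vertex not in $S$ is adjacent to exactly $m>0$ vertices of $S$; an $s$-clique is a clique of size $s$. $NG(v,k,\lambda;m,s)$ denotes the set of non-complete edge-regular graphs with parameters $(v,k,\lambda)$ that contain an $m$-regular $s$-clique with $s\geq 2$. The square lattice graph $L_2(n)$ has vertex set $\{1,\dots,n\}^2$, two distinct vertices adjacent iff they agree in one coordinate. The triangular graph $T(n)$ has as vertices the $2$-subsets of $\{1,\dots,n\}$, two distinct vertices $A,B$ adjacent iff $|A\cap B|=1$. $K_{r\times t}$ is the complete multipartite graph with $r$ parts of size $t$. *)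

(* Defs.v *)
From mathcomp Require Import all_boot.
Set Implicit Arguments.
Unset Strict Implicit.
Unset Printing Implicit Defensive.

Record sgraph := SGraph {
  vertex :> finType;
  adj : rel vertex;
  adj_sym : symmetric adj;
  adj_irr : irreflexive adj
}.

Definition nbr (G : sgraph) (x : G) : {set G} := [set y | adj x y].

Definition regular (G : sgraph) (k : nat) : Prop :=
  forall x : G, #|nbr x| = k.

Definition edge_regular (G : sgraph) (v k lambda : nat) : Prop :=
  [/\ #|G| = v,
      exists x y : G, adj x y,
      regular G k
    & forall x y : G, adj x y -> #|nbr x :&: nbr y| = lambda].

Definition complete (G : sgraph) : Prop :=
  forall x y : G, x != y -> adj x y.

Definition strongly_regular (G : sgraph) (v k lambda mu : nat) : Prop :=
  [/\ edge_regular G v k lambda,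
      ~ complete G
    & forall x y : G, x != y -> ~~ adj x y -> #|nbr x :&: nbr y| = mu].

Definition clique (G : sgraph) (S : {set G}) : Prop :=
  {in S &, forall x y, x != y -> adj x y}.

Definition regular_clique (G : sgraph) (m : nat) (S : {set G}) : Prop :=
  [/\ clique S,
      0 < m
    & forall x : G, x \notin S -> #|nbr x :&: S| = m].

Definition NG (v k lambda m s : nat) (G : sgraph) : Prop :=
  [/\ edge_regular G v k lambda,
      ~ complete G,
      2 <= s
    & exists S : {set G}, regular_clique m S /\ #|S| = s].

Definition isomorphic (G H : sgraph) : Prop :=
  exists2 f : G -> H, bijective f & forall x y, adj (f x) (f y) = adj x y.

Section Lattice.
Variable n : nat.
Definition L2_adj : rel ('I_n * 'I_n) :=
  fun x y => (x != y) && ((x.1 == y.1) || (x.2 == y.2)).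
Lemma L2_sym : symmetric L2_adj.
Proof.
by move=> x y; rewrite /L2_adj eq_sym (eq_sym x.1) (eq_sym x.2).
Qed.
Lemma L2_irr : irreflexive L2_adj.
Proof. by move=> x; rewrite /L2_adj eqxx. Qed.
Definition L2 : sgraph := SGraph L2_sym L2_irr.
End Lattice.

Section Triangular.
Variable n : nat.
Definition pair2 : finType := {A : {set 'I_n} | #|A| == 2}.
Definition triangular_adj : rel pair2 :=
  fun A B => (A != B) && (#|val A :&: val B| == 1).
Lemma triangular_sym : symmetric triangular_adj.
Proof. by move=> A B; rewrite /triangular_adj eq_sym setIC. Qed.
Lemma triangular_irr : irreflexive triangular_adj.
Proof. by move=> A; rewrite /triangular_adj eqxx. Qed.
Definition triangular : sgraph := SGraph triangular_sym triangular_irr.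
End Triangular.

Section CompleteMultipartite.
Variables r t : nat.
(* (i, a) is the a-th vertex of the i-th part *)
Definition multipartite_adj : rel ('I_r * 'I_t) := fun x y => x.1 != y.1.
Lemma multipartite_sym : symmetric multipartite_adj.
Proof. by move=> x y; rewrite /multipartite_adj eq_sym. Qed.
Lemma multipartite_irr : irreflexive multipartite_adj.
Proof. by move=> x; rewrite /multipartite_adj eqxx. Qed.
Definition multipartite : sgraph := SGraph multipartite_sym multipartite_irr.
End CompleteMultipartite.

(* Main.v *)
Require Import Defs.
From mathcomp Require Import all_boot all_order all_algebra.
From mathcomp Require Import zify.

Set Implicit Arguments.
Unset Strict Implicit.
Unset Printing Implicit Defensive.

(** For an edge xy, exactly k - lambda - 1 = s - m neighbours of x other than y
    are not adjacent to y.  If S is an m-regular s-clique, x lies in S and y does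
    not, the s - m vertices of S missed by y are such neighbours, so N(x) \ S is
    a clique.  Counting paths x y x' with x, x' in S and y outside gives
    k = 2(s - 1), so that {x} ∪ (N(x) \ S) is again an s-clique, and a variance
    argument shows that every s-clique is m-regular.  Hence every closed
    neighbourhood is the union of two s-cliques meeting in one vertex, which
    gives mu = 2m.  Moreover, for y outside S, every neighbour of y misses
    at most one vertex of N(y) ∩ S; counting these adjacencies yields k(m - 1) <= m lambda,
    that is m = 1, m = 2 or s = m + 1.  The three cases are the lattice, the
    triangular graph and the multipartite graph. *)

Lemma isomorphic_of_inj (G H : sgraph) (f : G -> H) :
  injective f -> #|H| <= #|G| ->
  (forall x y, adj (f x) (f y) = adj x y) -> isomorphic G H.
Proof. by move=> injf leHG adjf; exists f => //; apply: inj_card_bij. Qed.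

Lemma inj_in_ord (T : finType) (A : {set T}) (n : nat) :
  #|A| = n -> 0 < n -> exists i : T -> 'I_n, {in A &, injective i}.
Proof.
move=> <- /card_gt0P[x Ax]; exists (enum_rank_in Ax) => y z Ay Az.
by move/enum_rank_in_inj; apply.
Qed.

(** * Double counting of adjacencies, and the residue of a clique at a vertex *)

Section Counting.
Variable G : sgraph.
Implicit Types (x y z : G) (A B K : {set G}).

Lemma in_nbr x y : (y \in nbr x) = adj x y.
Proof. by rewrite inE. Qed.

Lemma adj_neq x y : adj x y -> x != y.
Proof. by apply: contraTneq => ->; rewrite adj_irr. Qed.

(** The weight serves second moments: [F] constant is the usual edge count between [A] and [B],
    while [F] equal to the degree into [B] gives sums of squares. *)
Lemma exchange_nbr A B (F : G -> nat) :
  \sum_(y in A) F y * #|nbr y :&: B| =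
  \sum_(x in B) \sum_(y in nbr x :&: A) F y.
Proof.
transitivity (\sum_(y in A) \sum_(x in nbr y :&: B) F y).
  by apply: eq_bigr => y _; rewrite sum_nat_const mulnC.
rewrite (exchange_big_dep (mem B)) /=; last by move=> y x _ /setIP[].
apply: eq_bigr => x Bx; apply: eq_bigl => y.
by rewrite !inE Bx andbT adj_sym andbC.
Qed.

Lemma double_count_nbr A B :
  \sum_(y in A) #|nbr y :&: B| = \sum_(x in B) #|nbr x :&: A|.
Proof.
have := exchange_nbr A B (fun=> 1).
under eq_bigr do rewrite mul1n; move=> ->.
by apply: eq_bigr => x _; rewrite sum1_card.
Qed.

Lemma nbrI_clique K x : clique K -> x \in K -> nbr x :&: K = K :\ x.
Proof.
move=> clK Kx; apply/setP => y; rewrite !inE andbC.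
case Ky: (y \in K); rewrite ?andbF // andbT.
apply/idP/idP => [/adj_neq|]; first by rewrite eq_sym.
by move=> yx; apply: clK => //; rewrite eq_sym.
Qed.

(** For a clique [K] containing [x], this is the part of the closed neighbourhood of [x] left over
    by [K], with [x] kept so that it can again be a clique through [x]. *)
Definition residue K x : {set G} := x |: (nbr x :\: K).

Lemma card_residue K x :
  clique K -> x \in K -> #|residue K x| + #|K| = #|nbr x| + 2.
Proof.
move=> clK Kx; rewrite cardsU1 !inE Kx /=.
have := cardsID K (nbr x); rewrite nbrI_clique //.
have := cardsD1 x K; rewrite Kx; lia.
Qed.

Lemma residueI K x : x \in K -> residue K x :&: K = [set x].
Proof.
move=> Kx; apply/setP => y; rewrite !inE.
by case: eqVneq => [->|_] /=; rewrite ?Kx // andbAC andNb.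
Qed.

Lemma in_residue K x y : y \notin K -> x \in K -> (y \in residue K x) = adj x y.
Proof.
move=> Ky Kx; rewrite !inE Ky; case: eqVneq => //= E.
by rewrite E Kx in Ky.
Qed.

End Counting.

(** * Local counts in an edge-regular graph with [k + m = lambda + s + 1] *)

Section EdgeRegular.
Variables (G : sgraph) (k lambda m s : nat).
Hypothesis regk : regular G k.
Hypothesis reglam : forall x y : G, adj x y -> #|nbr x :&: nbr y| = lambda.
Hypothesis kE : k + m = lambda + s + 1.
Implicit Types (x y z : G) (K : {set G}).

Lemma card_nbrD x y : adj x y -> #|nbr x :\: nbr y| + m = s + 1.
Proof. by move=> xy; have := cardsID (nbr y) (nbr x); rewrite reglam // regk; lia. Qed.

(* The s - m vertices of K missed by y already account for all the
   neighbours of x other than y that are not adjacent to y. *)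
Lemma clique_residue K x :
  regular_clique m K -> #|K| = s -> x \in K -> clique (residue K x).
Proof.
move=> [clK _ regK] cK Kx.
suff nbrK y z : y \in nbr x :\: K -> z \in nbr x :\: K -> y != z -> adj y z.
  move=> y z /setU1P[->|Dy] /setU1P[->|Dz]; rewrite ?eqxx //.
  - by move: Dz; rewrite !inE => /andP[].
  - by move: Dy; rewrite !inE adj_sym => /andP[].
  by apply: nbrK.
rewrite !inE => /andP[Ky xy] /andP[Kz xz] yz; apply: contraNT Kz => nyz.
have sub : y |: (K :\: nbr y) \subset nbr x :\: nbr y.
  apply/subsetP => w; rewrite !inE => /predU1P[->|/andP[nyw Kw]].
    by rewrite adj_irr.
  rewrite nyw clK //; apply: contraNneq nyw => <-; by rewrite adj_sym.
have /eqP E : y |: (K :\: nbr y) == nbr x :\: nbr y.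
  rewrite eqEcard sub cardsU1 !inE (negbTE Ky) andbF /=.
  have := card_nbrD xy; have := cardsID (nbr y) K.
  by rewrite setIC regK //; lia.
have : z \in nbr x :\: nbr y by rewrite !inE nyz.
by rewrite -E !inE eq_sym (negbTE yz) => /andP[].
Qed.

(** Of the [lambda] common neighbours of [x] and [x'], exactly [#|K| - 2] lie in [K]. *)
Lemma card_common_outside K x x' :
    clique K -> x \in K -> x' \in K -> x != x' ->
  #|nbr x' :&: (nbr x :\: K)| + #|K| = lambda + 2.
Proof.
move=> clK Kx Kx' xx'.
have := cardsID K (nbr x' :&: nbr x).
rewrite reglam; last by rewrite adj_sym clK.
rewrite setIDA -setIA (nbrI_clique clK Kx).
have -> : nbr x' :&: (K :\ x) = K :\ x' :\ x.
  by rewrite !setDE setIA (nbrI_clique clK Kx') setDE.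
have := cardsD1 x' K; have := cardsD1 x (K :\ x').
rewrite !inE Kx Kx' xx' /=; lia.
Qed.

(** Paths from [x] through [y] outside [K] back to [x'] in [K], sorted by [x']: [x' = x] gives one
    per [y], and each other [x'] gives [lambda + 2 - #|K|]. The negative terms are moved across to
    avoid truncated subtraction. *)
Lemma sum_nbr_outside K x :
    clique K -> x \in K ->
  \sum_(y in nbr x :\: K) #|nbr y :&: K| + (#|K| - 1) * #|K| =
  #|nbr x :\: K| + (#|K| - 1) * (lambda + 2).
Proof.
move=> clK Kx.
have -> : \sum_(y in nbr x :\: K) #|nbr y :&: K| =
          \sum_(y in nbr x :\: K) (1 + #|nbr y :&: (K :\ x)|).
  apply: eq_bigr => y; rewrite !inE => /andP[_ xy].
  by rewrite (cardsD1 x) setIDA !inE Kx adj_sym xy.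
rewrite big_split /= sum1_card double_count_nbr -addnA; congr (_ + _).
have -> : #|K| - 1 = #|K :\ x| by rewrite (cardsD1 x K) Kx; lia.
rewrite -!sum_nat_const -big_split /=; apply: eq_bigr => x'.
by rewrite !inE => /andP[x'x Kx']; rewrite card_common_outside // eq_sym.
Qed.

(** * Parameters forced by a regular clique, and regularity of all s-cliques *)

Section Cliques.
Variable S : {set G}.
Hypothesis ncG : ~ complete G.
Hypothesis s_ge2 : 2 <= s.
Hypothesis regS : regular_clique m S.
Hypothesis cardS : #|S| = s.

Lemma m_gt0 : 0 < m. Proof. by case: regS. Qed.

Lemma outside_S : exists y, y \notin S.
Proof.
case: regS => clS _ _.
have [S0|[y]] := set_0Vmem (~: S); last by rewrite inE => Sy; exists y.
by case: ncG => x y; apply: clS; rewrite -[S]setCK S0 !inE.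
Qed.

(** If [m = s], a vertex of [S] is adjacent to all others, so [k] is one less than the order and the
    graph is complete. *)
Lemma m_lt_s : m < s.
Proof.
case: regS => clS m0 nS; have [y Sy] := outside_S.
have lems : m <= s by rewrite -(nS y Sy) -cardS subset_leq_card ?subsetIr.
rewrite ltn_neqAle lems andbT; apply: contra_notN ncG => /eqP ms.
have /card_gt0P[x Sx] : 0 < #|S| by lia.
have nx : nbr x = [set~ x].
  apply/setP => z; rewrite !inE.
  have [->|zx] := eqVneq z x; first by rewrite adj_irr.
  have [Sz|Sz] := boolP (z \in S); first by rewrite clS // eq_sym.
  suff /setIP[] : x \in nbr z :&: S by rewrite inE adj_sym.
  suff /eqP -> : nbr z :&: S == S by [].
  by rewrite eqEcard subsetIr nS // ms cardS leqnn.
move=> a b ab; suff -> : adj a b = (b \in [set~ a]) by rewrite !inE eq_sym.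
have /eqP <- : nbr a == [set~ a]; last by rewrite inE.
rewrite eqEcard cardsC1 regk -(regk x) nx cardsC1 leqnn andbT.
by apply/subsetP => z; rewrite !inE eq_sym; apply: adj_neq.
Qed.

Lemma card_nbrD_clique K x :
  clique K -> x \in K -> #|K| = s -> #|nbr x :\: K| + s = k + 1.
Proof.
move=> clK Kx cK; have := cardsID K (nbr x); rewrite nbrI_clique // regk.
by have := cardsD1 x K; rewrite Kx cK; lia.
Qed.

Lemma k_eq : k = 2 * (s - 1).
Proof.
have [clS m0 nS] := regS; have ms := m_lt_s.
have /card_gt0P[x Sx] : 0 < #|S| by lia.
have := sum_nbr_outside clS Sx; have := card_nbrD_clique clS Sx cardS.
under eq_bigr => y do [rewrite inE => /andP[Sy _]; rewrite nS //].
rewrite sum_nat_const cardS; set r := #|_|; move=> rE E.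
(* With [r = k + 1 - s], eliminating [lambda] from [r * m + (s - 1) * s = r + (s - 1) * (lambda +
   2)] leaves a common factor [s - m], which is positive. *)
have : r * (s - m) = (s - 1) * (s - m) by nia.
by move/eqP; rewrite eqn_pmul2r; last lia; move/eqP; lia.
Qed.

Lemma lambda_eq : lambda + 3 = s + m.
Proof. by have := k_eq; lia. Qed.

Lemma sum_nbr_clique K : clique K -> #|K| = s ->
  \sum_(y in ~: K) #|nbr y :&: K| = s * (s - 1).
Proof.
move=> clK cK; rewrite double_count_nbr -{1}cK -sum_nat_const.
apply: eq_bigr => x Kx; rewrite -setDE.
by have := card_nbrD_clique clK Kx cK; have := k_eq; lia.
Qed.

Lemma card_G : m * #|G| = m * s + s * (s - 1).
Proof.
have [clS _ nS] := regS.
rewrite -(sum_nbr_clique clS cardS) -(cardsC S) cardS mulnDr; congr (_ + _).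
by rewrite mulnC -sum_nat_const; apply: eq_bigr => y; rewrite inE => /nS.
Qed.

(* The degrees d into K of the vertices outside K have mean m, and
   counting pairs gives \sum d ^ 2 = m * \sum d, so their variance is 0. *)
Lemma regular_s_clique K : clique K -> #|K| = s -> regular_clique m K.
Proof.
move=> clK cK; split => // [|y0]; first exact: m_gt0.
pose d (y : G) := #|nbr y :&: K|.
have sumd : \sum_(y in ~: K) d y = s * (s - 1) by apply: sum_nbr_clique.
have sum1 : \sum_(y in ~: K) m = s * (s - 1).
  rewrite sum_nat_const; have := cardsC K; have := card_G; rewrite cK; nia.
have sumdd : \sum_(y in ~: K) d y ^ 2 = s * (s - 1) * m.
  rewrite (eq_bigr (fun y => d y * #|nbr y :&: K|)); last by move=> y; rewrite expnS expn1.
  (* Each [x] in [K] contributes [(s - 1) * (lambda + 3 - s) = (s - 1) * m]. *)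
  rewrite exchange_nbr -mulnA -{1}cK -sum_nat_const; apply: eq_bigr => x Kx.
  rewrite -setDE; have := sum_nbr_outside clK Kx; rewrite -/d cK.
  have := card_nbrD_clique clK Kx cK; have := k_eq; have := lambda_eq.
  rewrite /d; nia.
have eq_sum : \sum_(y in ~: K) 2 * (d y * m) = \sum_(y in ~: K) (d y ^ 2 + m ^ 2).
  rewrite -big_distrr -big_distrl big_split /= sumdd sumd mul2n -addnn.
  by congr (_ + _); rewrite -sum1 big_distrl; apply: eq_bigr => y _; rewrite expnS expn1.
(* Equality of the sums forces equality in every term of [2 * (d y * m) <= d y ^ 2 + m ^ 2], hence
   [d y = m]. *)
have [_] := leqif_sum (fun y (_ : y \in ~: K) => nat_Cauchy (d y) m).
rewrite eq_sum eqxx => /esym/forall_inP E Ky0.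
by apply/eqP/E; rewrite inE.
Qed.

(** * Residues as s-cliques, and the value of mu *)

Lemma s_clique_residue K x : clique K -> #|K| = s -> x \in K ->
  clique (residue K x) /\ #|residue K x| = s.
Proof.
move=> clK cK Kx; split; first exact: clique_residue (regular_s_clique clK cK) cK Kx.
by have := card_residue clK Kx; rewrite regk cK; have := k_eq; lia.
Qed.

Lemma s_clique_cover y : exists K, [/\ clique K, #|K| = s & y \in K].
Proof.
have [clS m0 nS] := regS.
have [Sy|Sy] := boolP (y \in S); first by exists S.
have /card_gt0P[x] : 0 < #|nbr y :&: S| by rewrite nS.
rewrite !inE => /andP[yx Sx]; exists (residue S x).
have [cl c] := s_clique_residue clS cardS Sx.
by split; rewrite // in_residue // adj_sym.
Qed.

(** The neighbours of [x] split into [K :\ x] and [residue K x :\ x]. Both cliques are m-regular and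
    miss [y], and [x] itself is not a neighbour of [y], so each part contributes [m]. *)
Lemma card_common_nonadj x y :
  x != y -> ~~ adj x y -> #|nbr x :&: nbr y| = 2 * m.
Proof.
move=> xy nxy; have [K [clK cK Kx]] := s_clique_cover x.
have [clR cR] := s_clique_residue clK cK Kx.
have [_ _ nK] := regular_s_clique clK cK.
have [_ _ nR] := regular_s_clique clR cR.
have Ky : y \notin K by apply: contra nxy => Ky; apply: clK.
have Ry : y \notin residue K x by rewrite in_residue.
have nyx : x \notin nbr y by rewrite inE adj_sym.
rewrite setIC -(cardsID K) mul2n -addnn -{1}(nK y Ky) -(nR y Ry).
congr (_ + _); apply: eq_card => z; rewrite !inE.
  have [->|zx] := eqVneq z x; first by rewrite adj_sym (negbTE nxy).
  by case Kz: (z \in K); rewrite ?andbF // (clK x z) // ?andbT // eq_sym.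
have [->|zx] := eqVneq z x; first by rewrite adj_sym (negbTE nxy) /= andbF.
by rewrite andbCA andbA.
Qed.

(* The neighbours of y outside the s-clique residue S x' form, together with
   y, another s-clique; it contains x, and also z unless z ~ x'. *)
Lemma adj_or_adj y z x x' : y \notin S -> adj y z ->
    x \in S -> x' \in S -> adj y x -> adj y x' -> x != x' ->
  adj z x || adj z x'.
Proof.
move=> Sy yz Sx Sx' yx yx' xx'.
have [clS m0 nS] := regS.
have [clR cR] := s_clique_residue clS cardS Sx'.
have Ry : y \in residue S x' by rewrite in_residue // adj_sym.
have [clR' _] := s_clique_residue clR cR Ry.
case nzx': (adj z x'); rewrite ?orbT // orbF.
have [->|zx'] := eqVneq z x'; first by rewrite clS // eq_sym.
have [zE|xz] := eqVneq x z; first by rewrite -zE clS in nzx'.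
apply: clR'; rewrite ?(eq_sym z) // !inE.
  rewrite yz (negbTE zx') adj_sym nzx' andbF /= .
  by rewrite orbT.
by rewrite yx Sx (negbTE xx') /= orbT.
Qed.

(** * The trichotomy for [m] *)

Lemma m_cases : [\/ m = 1, m = 2 | s = m.+1].
Proof.
have [clS m0 nS] := regS; have [y Sy] := outside_S.
pose A := nbr y :&: S; have cA : #|A| = m by apply: nS.
have leA z : z \in nbr y -> m - 1 <= #|nbr z :&: A|.
  rewrite inE => yz.
  suff: #|A :\: nbr z| <= 1 by have := cardsID (nbr z) A; rewrite setIC cA; lia.
  apply/card_le1_eqP => x x'; rewrite !inE => /and3P[nzx yx Sx] /and3P[nzx' yx' Sx'].
  apply/eqP; apply: contraNT nzx => xx'.
  by have := adj_or_adj Sy yz Sx Sx' yx yx'; rewrite eq_sym (negbTE nzx') orbF; apply.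
have : \sum_(z in nbr y) (m - 1) <= \sum_(z in nbr y) #|nbr z :&: A|.
  exact: leq_sum.
rewrite sum_nat_const regk double_count_nbr.
under eq_bigr => x do [rewrite inE => /andP[yx _]; rewrite setIC reglam;
  last by rewrite in_nbr in yx].
rewrite sum_nat_const cA; have := m_lt_s; have := k_eq; have := lambda_eq.
case: (m) m0 => [|[|[|n]]] // _ lE kE' lt le; try by constructor.
(* The inequality amounts to [(m - 2) * (s - m - 1) <= 0]; here [m >= 3] and [m < s]. *)
constructor 3; nia.
Qed.

(** * The complete multipartite case *)

Lemma isomorphic_multipartite : s = m.+1 -> isomorphic G (multipartite s 2).
Proof.
move=> sm; have [clS m0 nS] := regS.
have cG : #|G| = s * 2 by have := card_G; rewrite sm; nia.
(* Here [k] is two less than the order, so [y] has exactly one non-neighbour besides itself. *)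
have cN y : #|~: nbr y| = 2.
  by have := cardsC (nbr y); have := k_eq; rewrite regk cG; lia.
have nonadj y : exists2 x, x \in S & ~~ adj x y.
  have [Sy|Sy] := boolP (y \in S); first by exists y; rewrite ?adj_irr.
  have /card_gt0P[x] : 0 < #|S :\: nbr y|.
    by have := cardsID (nbr y) S; rewrite setIC nS // cardS; lia.
  by rewrite !inE adj_sym => /andP[nyx Sx]; exists x.
(* [n y] is the representative in [S] of the part of [y]: [y] itself if [y] is in [S], and otherwise
   its only other non-neighbour. *)
have [n Sn nadj] := fin_all_exists2 nonadj.
have two x y z : ~~ adj x y -> ~~ adj x z -> x != y -> x != z -> y = z.
  move=> xy xz nxy nxz; apply/eqP; apply: contraT => yz.
  have : [set x; y; z] \subset ~: nbr x.
    by apply/subsetP => w; rewrite !inE => /orP[/orP[]|] /eqP->; rewrite ?adj_irr.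
  by move/subset_leq_card; rewrite cN -setUA cardsU1 cards2 !inE (negbTE nxy) (negbTE nxz) yz.
have [i iI] : exists i : G -> 'I_s, {in S &, injective i} by apply: inj_in_ord; lia.
have nS_id y : y \in S -> n y = y.
  by move=> Sy; apply/eqP; apply: contraNT (nadj y) => /clS ->.
pose f y : multipartite s 2 := (i (n y), if y \in S then ord0 else ord_max).
have nE y z : (n y == n z) = ~~ adj y z.
  apply/eqP/idP => [nyz|nyz].
    have [->|yz] := eqVneq y z; first by rewrite adj_irr.
    have [<-|xy] := eqVneq (n y) y; first by rewrite nyz.
    have [<-|xz] := eqVneq (n z) z; first by rewrite -nyz adj_sym.
    by case/eqP: yz; apply: (two (n y)); rewrite ?nadj // nyz ?nadj.
  have [->//|yz] := eqVneq y z; have zy : z != y by rewrite eq_sym.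
  have [yE|ny] := eqVneq y (n y).
    have [zE|nz] := eqVneq z (n z).
      by case/negP: nyz; rewrite clS // 1?yE 1?zE.
    by rewrite -yE; apply: (two z); rewrite // adj_sym // nadj.
  have <- : z = n y by apply: (two y); rewrite // adj_sym // nadj.
  have [//|nz] := eqVneq z (n z).
  have zny : z = n y by apply: (two y); rewrite // adj_sym // nadj.
  by case/eqP: nz; rewrite nS_id // zny.
apply: (isomorphic_of_inj (f := f)).
- move=> y z [/iI nyz]; have {}nyz : n y = n z by apply: nyz.
  have [Sy|Sy] := boolP (y \in S); have [Sz|Sz] // := boolP (z \in S).
    by rewrite -(nS_id y) // -(nS_id z).
  move=> _; apply: (two (n y)); rewrite ?nadj //.
  + by rewrite nyz nadj.
  + by apply: contraNneq Sy => <-.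
  by apply: contraNneq Sz => <-; rewrite nyz.
- by rewrite card_prod !card_ord cG.
by move=> y z; rewrite /= /multipartite_adj /= (inj_in_eq iI) // nE negbK.
Qed.

Lemma residue_cover K y :
  clique K -> #|K| = s -> exists2 x, x \in K & y \in residue K x.
Proof.
move=> clK cK; have [_ m0 nK] := regular_s_clique clK cK.
have [Ky|Ky] := boolP (y \in K); first by exists y; rewrite ?setU11.
have /card_gt0P[x] : 0 < #|nbr y :&: K| by rewrite nK.
by rewrite !inE => /andP[yx Kx]; exists x; rewrite // in_residue // adj_sym.
Qed.

(** * The triangular case *)

(** For [m = 2], [lambda = s - 1], so two vertices of [S] have exactly [lambda + 2 - s = 1] common
    neighbour outside [S]. *)
Lemma block_inj y z : m = 2 -> y \notin S -> z \notin S ->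
  nbr y :&: S = nbr z :&: S -> y = z.
Proof.
move=> m2 Sy Sz E; have [clS _ nS] := regS.
have /cards2P[x [x' [xx' A2]]] : #|nbr y :&: S| == 2 by rewrite nS // m2.
have [yx yx'] : x \in nbr y :&: S /\ x' \in nbr y :&: S by rewrite A2 !inE !eqxx orbT.
have [zx zx'] : x \in nbr z :&: S /\ x' \in nbr z :&: S by rewrite -E.
move: yx yx' zx zx'; rewrite !inE => /andP[yx Sx] /andP[yx' Sx'] /andP[zx _] /andP[zx' _].
have /card_le1_eqP eq1 : #|nbr x' :&: (nbr x :\: S)| <= 1.
  by have := card_common_outside clS Sx Sx' xx'; rewrite cardS; have := lambda_eq; lia.
by apply: (eq1 z y); rewrite !inE ?Sy ?Sz /= !(adj_sym x) !(adj_sym x') ?yx ?yx' ?zx ?zx'.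
Qed.

Lemma isomorphic_triangular : m = 2 -> isomorphic G (triangular s.+1).
Proof.
move=> m2; have [clS m0 nS] := regS.
have [i iI] : exists i : G -> 'I_s, {in S &, injective i} by apply: inj_in_ord; lia.
(* The symbol [ord0] stays free: [S] becomes the star of all pairs through [ord0], and an outside
   vertex becomes the pair of labels of its two neighbours in [S]. *)
pose j x : 'I_s.+1 := lift ord0 (i x).
have jI : {in S &, injective j} by move=> x x' Sx Sx' /lift_inj/iI; apply.
pose blk y : {set 'I_s.+1} := j @: (nbr y :&: S).
have blk0 y : ord0 \notin blk y.
  by apply/imsetP => -[x _ /eqP]; rewrite (negbTE (neq_lift _ _)).
have mem_blk x y : x \in S -> (j x \in blk y) = adj y x.
  move=> Sx; apply/imsetP/idP => [[x'] |yx]; last by exists x; rewrite // !inE yx.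
  by rewrite !inE => /andP[yx' Sx'] /jI ->.
pose g y := if y \in S then [set ord0; j y] else blk y.
have g2 y : #|g y| == 2.
  rewrite /g; case: ifPn => Sy; first by rewrite cards2 neq_lift.
  rewrite card_in_imset ?nS ?m2 // => x x' /setIP[_ Sx] /setIP[_ Sx'].
  exact: jI.
have gI : injective g.
  move=> y z; rewrite /g; case: ifPn => Sy; case: ifPn => Sz E.
  - have : j y \in [set ord0; j z] by rewrite -E !inE eqxx orbT.
    by rewrite !inE eq_sym (negbTE (neq_lift _ _)) => /eqP/jI ->.
  - by case/negP: (blk0 z); rewrite -E !inE eqxx.
  - by case/negP: (blk0 y); rewrite E !inE eqxx.
  apply: block_inj => //; apply/setP => x; rewrite !inE.
  by case Sx: (x \in S); rewrite ?andbF // -!mem_blk // E.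
have mix y z : y \in S -> z \notin S ->
    adj y z <-> exists2 t, t \in g y & t \in g z.
  move=> Sy Sz; rewrite /g Sy (negbTE Sz) adj_sym -mem_blk //; split.
    by move=> zy; exists (j y); rewrite // !inE eqxx orbT.
  by case=> t; rewrite !inE => /orP[] /eqP -> //; rewrite (negbTE (blk0 z)).
have meet y z : y != z -> adj y z <-> exists2 t, t \in g y & t \in g z.
  move=> yz; have [Sy|Sy] := boolP (y \in S); have [Sz|Sz] := boolP (z \in S).
  - by rewrite clS // /g Sy Sz; split=> // _; exists ord0; rewrite !inE eqxx.
  - exact: mix.
  - by rewrite adj_sym mix //; split=> -[t]; exists t.
  rewrite /g (negbTE Sy) (negbTE Sz); split=> [ayz|[t /imsetP[x]]].
    have /cards2P[x [x' [xx' A2]]] : #|nbr y :&: S| == 2 by rewrite nS // m2.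
    have : x \in nbr y :&: S /\ x' \in nbr y :&: S by rewrite A2 !inE !eqxx orbT.
    rewrite !inE => -[/andP[yx Sx] /andP[yx' Sx']].
    have /orP[zx|zx'] := adj_or_adj Sy ayz Sx Sx' yx yx' xx'.
      by exists (j x); rewrite mem_blk.
    by exists (j x'); rewrite mem_blk.
  rewrite !inE => /andP[yx Sx] ->; rewrite mem_blk // => zx.
  (* Outside vertices with a common neighbour [x] in [S] both lie in the clique [residue S x]. *)
  have [clR _] := s_clique_residue clS cardS Sx.
  by apply: clR; rewrite // in_residue // adj_sym.
pose f y : triangular s.+1 := exist _ (g y) (g2 y).
have fI : injective f by move=> y z [/gI].
apply: (isomorphic_of_inj fI).
  have -> : #|triangular s.+1| = 'C(s.+1, 2).
    by rewrite card_sig -[in RHS](card_ord s.+1) -card_draws cardsE.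
  have := mul_bin_diag s.+1 1; have := card_G; rewrite m2 bin1; nia.
move=> y z; rewrite /= /triangular_adj (inj_eq fI).
have [->|yz] := eqVneq y z; first by rewrite adj_irr.
rewrite /=; apply/idP/idP => [/cards1P[t E]|].
  have /setIP[ty tz] : t \in g y :&: g z by rewrite E inE.
  by apply/(meet _ _ yz); exists t.
case/(meet _ _ yz) => t ty tz; rewrite eqn_leq card_gt0 andbC.
apply/andP; split; first by apply/set0Pn; exists t; rewrite inE ty.
rewrite leqNgt; apply: contra yz => c2; apply/eqP/gI.
have /eqP <- : g y :&: g z == g y by rewrite eqEcard subsetIl (eqP (g2 y)).
by apply/eqP; rewrite eqEcard subsetIr (eqP (g2 z)).
Qed.

(** * The lattice case *)

(** A vertex outside [K] has a single neighbour in [K], and a vertex of [K] lies only in its own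
    residue; so the residues along [K] partition the graph. *)
Lemma residue_uniq K x x' z : m = 1 -> clique K -> #|K| = s ->
  x \in K -> x' \in K -> z \in residue K x -> z \in residue K x' -> x = x'.
Proof.
move=> m1 clK cK Kx Kx' zx zx'; have [_ _ nK] := regular_s_clique clK cK.
have [Kz|Kz] := boolP (z \in K).
  have /set1P <- : z \in [set x] by rewrite -(residueI Kx) inE zx.
  by apply/set1P; rewrite -(residueI Kx') inE zx'.
have /card_le1_eqP eq1 : #|nbr z :&: K| <= 1 by rewrite nK // m1.
by apply: (eq1 x' x); rewrite !inE adj_sym -(in_residue Kz) ?zx ?zx'.
Qed.

(** For [m = 1], [lambda = s - 2], so an s-clique through [y] and [z] must consist of them and all
    their common neighbours. *)
Lemma s_cliques_share_edge K K' y z : m = 1 -> clique K -> #|K| = s ->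
    clique K' -> #|K'| = s -> y != z ->
  y \in K -> z \in K -> y \in K' -> z \in K' -> K = K'.
Proof.
move=> m1 clK cK clK' cK' yz Ky Kz K'y K'z.
pose N := [set y; z] :|: (nbr y :&: nbr z).
have NE (L : {set G}) : clique L -> #|L| = s -> y \in L -> z \in L -> L = N.
  move=> clL cL Ly Lz; apply/eqP; rewrite eqEcard; apply/andP; split.
    apply/subsetP => w Lw; rewrite !inE.
    have [//|wy] := eqVneq w y; have [//|wz] := eqVneq w z.
    by rewrite !clL // eq_sym.
  apply: leq_trans (leq_card_setU _ _) _.
  by rewrite cards2 yz reglam ?clL // cL; have := lambda_eq; lia.
by rewrite (NE K) // (NE K').
Qed.

Lemma isomorphic_lattice : m = 1 -> isomorphic G (L2 s).
Proof.
move=> m1; have [clS m0 nS] := regS.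
have /card_gt0P[x0 Sx0] : 0 < #|S| by lia.
(* [S] and [C] act as coordinate axes crossing at [x0]; the residues along each form one parallel
   class of lines, and [p], [q] are the coordinates. *)
pose C := residue S x0; have [clC cC] := s_clique_residue clS cardS Sx0.
have Cx0 : x0 \in C by apply: setU11.
have [p Sp yp] := fin_all_exists2 (fun y => residue_cover y clS cardS).
have [q Cq yq] := fin_all_exists2 (fun y => residue_cover y clC cC).
have pE x y : x \in S -> (y \in residue S x) = (p y == x).
  move=> Sx; apply/idP/eqP => [yx|<-]; last exact: yp.
  exact: residue_uniq m1 clS cardS _ _ (yp y) yx.
have qE c y : c \in C -> (y \in residue C c) = (q y == c).
  move=> Cc; apply/idP/eqP => [yc|<-]; last exact: yq.
  exact: residue_uniq m1 clC cC _ _ (yq y) yc.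
(* No line belongs to both classes: since [S] lies in [residue C x0], equality forces [c = x0] and
   then [x = x0], so [C] would equal [residue C x0], which meets [C] in one point only. *)
have residue_neq x c : x \in S -> c \in C -> residue S x <> residue C c.
  move=> Sx Cc E.
  have xc : x \in residue C c by rewrite -E setU11.
  have xx0 : x \in residue C x0.
    have [->|xx0] := eqVneq x x0; first exact: setU11.
    have Cx : x \notin C.
      apply: contra xx0 => Cx; rewrite -in_set1 -(residueI Sx0).
      by rewrite inE Cx.
    by rewrite in_residue // clS // eq_sym.
  have cx0 : c = x0 by apply: residue_uniq m1 clC cC Cc Cx0 xc xx0.
  have xE : x0 = x.
    by apply/set1P; rewrite -(residueI Sx) inE Sx0 andbT E cx0 setU11.
  have := residueI Cc; rewrite -E -xE setIid => /(congr1 (fun A => #|pred_of_set A|)).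
  by rewrite cards1 cC; lia.
have [i iI] : exists i : G -> 'I_s, {in S &, injective i} by apply: inj_in_ord; lia.
have [j jI] : exists j : G -> 'I_s, {in C &, injective j} by apply: inj_in_ord cC _; lia.
pose RS y := residue S (p y); pose RC y := residue C (q y).
have RS_clique y : clique (RS y) /\ #|RS y| = s by apply: s_clique_residue.
have RC_clique y : clique (RC y) /\ #|RC y| = s by apply: s_clique_residue.
have RSC y z : z \in RS y -> z \in RC y -> y = z.
  move=> zS zC; apply/eqP; apply: contraT => yz.
  have [clRS cRS] := RS_clique y; have [clRC cRC] := RC_clique y.
  case: (@residue_neq (p y) (q y)) => //.
  exact: s_cliques_share_edge m1 clRS cRS clRC cRC yz (yp y) zS (yq y) zC.
(* The two lines through [y] meet only in [y], so they supply [2 * (s - 1) = k] neighbours, which is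
   all of them. *)
have nbrE y : nbr y = (RS y :\ y) :|: (RC y :\ y).
  have [clRS cRS] := RS_clique y; have [clRC cRC] := RC_clique y.
  apply/eqP; rewrite eq_sym eqEcard; apply/andP; split.
    apply/subsetP => z; rewrite !in_setU !in_setD1 in_nbr.
    by case/orP=> /andP[zy zR]; [apply: clRS|apply: clRC]; rewrite ?yp ?yq // eq_sym.
  rewrite regk cardsU.
  have -> : (RS y :\ y) :&: (RC y :\ y) = set0.
    apply/setP => z; rewrite in_setI !in_setD1 in_set0; apply/negP.
    by case/andP=> /andP[zy zS] /andP[_ zC]; rewrite (RSC y z) ?eqxx in zy.
  rewrite cards0; have := cardsD1 y (RS y); have := cardsD1 y (RC y).
  by rewrite yp yq cRS cRC; have := k_eq; lia.
pose f y : L2 s := (i (p y), j (q y)).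
have fI : injective f.
  move=> y z [/iI pyz /jI qyz]; apply: RSC.
    by rewrite /RS pE // pyz.
  by rewrite /RC qE // qyz.
apply: (isomorphic_of_inj fI).
  by rewrite card_prod !card_ord; have := card_G; rewrite m1; nia.
move=> y z; rewrite /= /L2_adj (inj_eq fI) /= (inj_in_eq iI) // (inj_in_eq jI) //.
rewrite -in_nbr nbrE in_setU !in_setD1 -andb_orr pE // qE //.
by rewrite (eq_sym y) (eq_sym (p y)) (eq_sym (q y)).
Qed.

End Cliques.
End EdgeRegular.

(** * Strong regularity and the classification *)

Theorem theorem15 (v k lambda m s : nat) (G : sgraph)
    (hG : NG v k lambda m s G)
    (h : (k%:Z - lambda%:Z - s%:Z + m%:Z - 1 = 0)%R) :
  (exists mu : nat, strongly_regular G v k lambda mu) /\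
  [\/ isomorphic G (L2 s),
      3 <= s /\ isomorphic G (triangular s.+1)
    | isomorphic G (multipartite s 2)].
Proof.
have kE : k + m = lambda + s + 1 by lia.
have [erG ncG s2 [S [regS cS]]] := hG; have [_ _ regk reglam] := erG.
split.
  exists (2 * m); split=> // x y; exact: (card_common_nonadj regk reglam kE ncG s2 regS cS).
have [m1|m2|sm] := m_cases regk reglam kE ncG s2 regS cS.
- by constructor 1; apply: (isomorphic_lattice regk reglam kE ncG s2 regS cS m1).
- constructor 2; split; last exact: (isomorphic_triangular regk reglam kE ncG s2 regS cS m2).
  by have := m_lt_s regk kE ncG s2 regS cS; rewrite m2.
by constructor 3; apply: (isomorphic_multipartite regk reglam kE ncG s2 regS cS sm).
Qed.
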